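(* A locally semicomplete digraph $D$ is chordal if and only if $S(D)$ is chordal and $D$ contains as an induced subdigraph neither a directed cycle consisting of non-symmetric arcs nor any of the digraphs $F_a, F_b, F_c, F_d$ described in the context.
   Context: Digraphs are finite, have no loops and no multiple arcs, but may contain digons; an arc lying in a digon is called symmetric, otherwise non-symmetric. $N^-(v)$ / $N^+(v)$ denote the sets of in-/out-neighbours of $v$. A vertex $v$ is di-simplicial if for every $u \in N^-(v)$ and $w \in N^+(v)$ with $u \neq w$, $uw$ is an arc. A digraph is chordal if every induced subdigraph contains a di-simplicial vertex. $S(D)$ is the spanning subdigraph of $D$ consisting of all symmetric arcs of $D$. A digraph is semicomplete if between any two distinct vertices there is at least one arc; $D$ is locally semicomplete if for every vertex $v$, both $N^-(v)$ and $N^+(v)$ induce semicomplete subdigraphs. The digraphs $F_a,F_b,F_c$ have vertex set $\{1,2,3,4\}$ with symmetric arcs $1\leftrightarrow 3$ and $2 \leftrightarrow 4$, plus: $F_a$: non-symmetric arcs $1\to2$, $2\to3$, $4\to1$ and symmetric arc $3\leftrightarrow4$; $F_b$: non-symmetric arcs $1\to2$, $2\to3$, $3\to4$, $4\to1$; $F_c$: non-symmetric arcs $1\to2$, $2\to3$, $4\to3$, $4\to1$. $F_d$ is the directed 3-cycle $1\to2\to3\to1$ with all arcs non-symmetric. *)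

(* Defs.v *)
(* A digraph is a finite type T of vertices with an arc
   relation e : rel T (e x y = there is an arc x -> y); loops are excluded
   by the hypothesis [irreflexive e]; multiple arcs cannot occur. *)
From mathcomp Require Import all_boot.
Set Implicit Arguments. Unset Strict Implicit. Unset Printing Implicit Defensive.

Section Digraphs.
Variable T : finType.

Definition disimplicial_in (e : rel T) (A : {set T}) (v : T) : Prop :=
  v \in A /\
  forall u w, u \in A -> w \in A -> e u v -> e v w -> u != w -> e u w.

Definition chordal (e : rel T) : Prop :=
  forall A : {set T}, A != set0 -> exists v, disimplicial_in e A v.

Definition sym_part (e : rel T) : rel T := fun x y => e x y && e y x.

Definition semicomplete_on (e : rel T) (P : pred T) : Prop :=
  forall x y, P x -> P y -> x != y -> e x y || e y x.
Definition locally_semicomplete (e : rel T) : Prop :=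
  forall v, semicomplete_on e (fun x => e x v) /\ semicomplete_on e (fun x => e v x).

Definition contains_induced (n : nat) (H : rel 'I_n) (e : rel T) : Prop :=
  exists f : 'I_n -> T, injective f /\ forall i j, e (f i) (f j) = H i j.

Definition dcycle_rel (k : nat) : rel 'I_k :=
  fun i j => (val j == (val i).+1 %% k) && ~~ (val i == (val j).+1 %% k).

Definition contains_induced_nonsym_dcycle (e : rel T) : Prop :=
  exists k, 3 <= k /\ contains_induced (@dcycle_rel k) e.
End Digraphs.

(* The digraphs F_a, F_b, F_c, F_d; paper vertex i is encoded as ordinal i-1. *)
Definition arcs_rel (n : nat) (s : seq (nat * nat)) : rel 'I_n :=
  fun i j => (val i, val j) \in s.

Definition Fa : rel 'I_4 := @arcs_rel 4
  [:: (0,2); (2,0); (1,3); (3,1); (0,1); (1,2); (3,0); (2,3); (3,2)].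
Definition Fb : rel 'I_4 := @arcs_rel 4
  [:: (0,2); (2,0); (1,3); (3,1); (0,1); (1,2); (2,3); (3,0)].
Definition Fc : rel 'I_4 := @arcs_rel 4
  [:: (0,2); (2,0); (1,3); (3,1); (0,1); (1,2); (3,2); (3,0)].
Definition Fd : rel 'I_3 := @arcs_rel 3 [:: (0,1); (1,2); (2,0)].

(* Main.v *)
(* Write [x -> y] for a nonsymmetric arc, [x ~ y] for a symmetric one, and say
   that [b] is covered by [a ~ c] when [a -> b -> c]. Excluding Fa, Fb and Fc
   means that [a -> b -> c -> d] never carries both [a ~ c] and [b ~ d]. Hence the
   set of vertices covered by [a ~ c] is closed under symmetric arcs leaving the
   neighbourhoods of [a] and [c], so Dirac's argument finds in it, once nonempty,
   a simplicial vertex of S(D).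
   A simplicial vertex [v] of S(D) is di-simplicial unless some [v ~ y] covers a
   vertex after [v] ([v -> x -> y]) or before it ([y -> x -> v]), or [i -> v -> o]
   with [i], [o] nonadjacent; call [v] good when the first and third cases do not
   occur. On good vertices [->] is transitive. If a good [v] had a vertex covered
   before it, by [y ~ v], then the last simplicial vertex covered by [y ~ v] would
   be good and precede [v]; so a first good vertex is di-simplicial. If there were
   no good vertex, every simplicial vertex would have a simplicial successor, and
   a shortest directed cycle among these is an induced cycle, or a 4-cycle with
   one chord, and the latter produces a good vertex. *)
Require Import Defs.
From mathcomp Require Import all_boot zify.
Set Implicit Arguments. Unset Strict Implicit. Unset Printing Implicit Defensive.

(** * Dirac's argument for simplicial vertices of chordal graphs *)

Section ChordalGraph.
Variables (T : finType) (s : rel T).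
Hypotheses (s_irr : irreflexive s) (s_sym : symmetric s) (s_chordal : chordal s).

Definition simplicial (v : T) :=
  [forall x, forall y, s v x ==> s v y ==> (x != y) ==> s x y].

Lemma simplicialP v :
  reflect (forall x y, s v x -> s v y -> x != y -> s x y) (simplicial v).
Proof.
apply: (iffP 'forall_forallP) => h x y; last first.
  by apply/implyP => sx; apply/implyP => sy; apply/implyP => ne; apply: h.
by move=> sx sy ne; have := h x y; rewrite sx sy ne.
Qed.

Lemma disimplicial_setD1 (A : {set T}) z v :
  disimplicial_in s (A :\ z) v -> ~~ s v z -> disimplicial_in s A v.
Proof.
move=> [/setD1P[vz vA] hv] nvz; split=> // x y xA yA sxv svy.
apply: hv; rewrite ?inE ?xA ?yA ?andbT //.
- by apply: contraNneq nvz => <-; rewrite s_sym.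
- by apply: contraNneq nvz => <-.
Qed.

Definition off (a v : T) := (v != a) && ~~ s a v.

Lemma off_disimplicial (A : {set T}) a z v :
  disimplicial_in s A z -> v \in A -> a \in A -> s z a -> off a v -> ~~ s v z.
Proof.
move=> [zA hz] vA aA sza /andP[va nav]; apply: contraNN nav => svz.
by rewrite s_sym; apply: hz.
Qed.

(* Dirac's lemma for a vertex ([a = c]) or an edge [ac]. *)
Lemma dirac (A : {set T}) a c b :
  a \in A -> c \in A -> (a == c) || s a c -> b \in A -> off a b -> off c b ->
  exists v, [/\ disimplicial_in s A v, off a v & off c v].
Proof.
have [m] := ubnP #|A|; elim: m A a c b => // m IH A a c b cardA aA cA ac bA oab ocb.
have [|z zP] := @s_chordal A; first by apply/set0Pn; exists a.
have zA := zP.1.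
have cardz : #|A :\ z| < m by move: cardA; rewrite (cardsD1 z A) zA.
have step x y : off x y -> y != x by case/andP.
(* a neighbour of z from which some vertex is off settles the case z = a *)
have nbr d b' : d \in A -> s z d -> b' \in A -> off d b' -> b' != z ->
    exists v, [/\ disimplicial_in s A v, off d v & off z v].
  move=> dA szd b'A odb' b'z.
  have dz : d != z by apply: contraTneq szd => ->; rewrite s_irr.
  have [||||||v [vP odv _]] := IH (A :\ z) d d b' cardz; rewrite ?inE ?dz ?b'z ?eqxx //.
  have /setD1P[vz vA] := vP.1.
  have nvz := off_disimplicial zP vA dA szd odv.
  exists v; split=> //; first exact: (disimplicial_setD1 vP).
  by rewrite /off vz s_sym.
have [za|za] := eqVneq z a.
  subst a; have [zc|zc] := eqVneq z c; last first.
    move: ac; rewrite (negbTE zc) /= => szc.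
    by have [v [? ? ?]] := nbr c b cA szc bA ocb (step _ _ oab); exists v.
  subst c; pose R := [set v in A | off z v].
  have [/existsP[d /and3P[dA szd /existsP[b' /andP[]]]]|noR] :=
    boolP [exists d, [&& d \in A, s z d & [exists b', (b' \in R) && off d b']]].
    rewrite inE => /andP[b'A ozb'] odb'.
    by have [v [? ? ?]] := nbr d b' dA szd b'A odb' (step _ _ ozb'); exists v.
  (* Now every neighbour of [z] is joined to all of [R]. A vertex simplicial in [R] has its other
     neighbours in the clique of neighbours of [z], so it stays simplicial in [A]. *)
  have [|v [vR vP]] := @s_chordal R.
    by apply/set0Pn; exists b; rewrite inE bA.
  move: (vR); rewrite inE => /andP[vA ozv].
  exists v; split=> //; split=> // x y xA yA sxv svy xy.
  have zN u : u \in A -> s u v -> u \notin R -> s z u.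
    rewrite !inE => -> suv /=; rewrite negb_and !negbK => /orP[/eqP uz|//].
    by move: ozv; rewrite /off -{2}uz suv andbF.
  have join u w : w \in R -> u \in A -> s z u -> u != w -> s u w.
    move=> wR uA szu uw; apply: contraNT noR => nuw.
    apply/existsP; exists u; rewrite uA szu /=; apply/existsP; exists w.
    by rewrite wR /off eq_sym uw.
  have [xR|/(zN _ xA sxv) szx] := boolP (x \in R).
    have [yR|yR] := boolP (y \in R); first exact: vP.
    by rewrite s_sym; apply: join => //; [apply: zN; rewrite // s_sym | rewrite eq_sym].
  have [yR|yR] := boolP (y \in R); first exact: join.
  by apply: zP.2 => //; [rewrite s_sym | apply: zN; rewrite // s_sym].
have [zc|zc] := eqVneq z c.
  subst c; have szA : s z a by move: ac; rewrite eq_sym (negbTE za) s_sym.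
  by have [v [? ? ?]] := nbr a b aA szA bA oab (step _ _ ocb); exists v.
have [/andP[oaz ocz]|noff] := boolP (off a z && off c z); first by exists z.
have bz : b != z by apply: contraNneq noff => <-; rewrite oab.
have inD x : x \in A -> x != z -> x \in A :\ z by move=> xA xz; rewrite !inE xz.
(* Delete [z]. If the resulting [v] were adjacent to [z], simpliciality of [z] would put [z] off
   both [a] and [c], the case already settled. *)
have [v [vP oav ocv]] :
    exists v, [/\ disimplicial_in s (A :\ z) v, off a v & off c v].
  by apply: (IH _ _ _ b) => //; apply: inD; rewrite // eq_sym.
exists v; split=> //; apply: (disimplicial_setD1 vP).
have /setD1P[_ vA] := vP.1.
have off_z x : x \in A -> z != x -> off x v -> s v z -> off x z.
  move=> xA zx oxv svz; rewrite /off zx s_sym; apply/negP => szx.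
  by move: (off_disimplicial zP vA xA szx oxv); rewrite svz.
by apply: contraNN noff => svz; rewrite !off_z.
Qed.

(** Dirac's lemma is applied after discarding the vertices outside [Q] that are off both [a] and
    [c]. The vertex found lies in [Q], and closure of [Q] ensures that none of its neighbours was
    discarded. *)
Lemma simplicial_in_closed (Q : {set T}) a c b :
  (a == c) || s a c -> {in Q, forall v, off a v && off c v} -> b \in Q ->
  (forall p q, p \in Q -> s p q -> off a q -> off c q -> q \in Q) ->
  exists2 v, v \in Q & simplicial v.
Proof.
move=> ac offQ bQ clQ.
pose A := [set v | (v \in Q) || ~~ (off a v && off c v)].
have [||||||v [vP oav ocv]] := @dirac A a c b; rewrite ?inE ?bQ ?orbT //;
  try by [rewrite /off eqxx ?andbF ?orbT | case/andP: (offQ b bQ)].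
have vQ : v \in Q by move: vP.1; rewrite inE oav ocv orbF.
exists v => //; apply/simplicialP => x y svx svy.
have inA u : s v u -> u \in A.
  move=> svu; rewrite inE; case: (boolP (_ && _)); rewrite ?orbT ?orbF // => /andP[? ?].
  exact: clQ svu _ _.
by apply: vP.2; rewrite ?inA // s_sym.
Qed.

End ChordalGraph.

(** * Adjacency types and the forbidden configurations *)

Section LocallySemicomplete.
Variables (T : finType) (e : rel T).
Hypotheses (e_irr : irreflexive e) (e_lsc : locally_semicomplete e).
Hypotheses (e_chordal : chordal (sym_part e))
  (noC : ~ contains_induced_nonsym_dcycle e)
  (noFa : ~ contains_induced Fa e) (noFb : ~ contains_induced Fb e)
  (noFc : ~ contains_induced Fc e) (noFd : ~ contains_induced Fd e).

Local Notation s := (sym_part e).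
Definition nsym x y := e x y && ~~ e y x.
Local Notation n := nsym.
Definition nonadj x y := [&& x != y, ~~ e x y & ~~ e y x].

Lemma s_irr : irreflexive s.
Proof. by move=> x; rewrite /sym_part e_irr. Qed.

Lemma s_symm : symmetric s.
Proof. by move=> x y; rewrite /sym_part andbC. Qed.

Lemma n_irr : irreflexive n.
Proof. by move=> x; rewrite /nsym e_irr. Qed.

Lemma nonadj_sym : symmetric nonadj.
Proof. by move=> x y; rewrite /nonadj eq_sym [X in _ && X]andbC. Qed.

Lemma n_arc x y : n x y -> e x y. Proof. by case/andP. Qed.
Lemma s_arc x y : s x y -> e x y. Proof. by case/andP. Qed.
Lemma s_arc' x y : s x y -> e y x. Proof. by case/andP. Qed.
Lemma n_asym x y : n x y -> n y x -> False.
Proof. by case/andP=> _ /negP h /andP[/h]. Qed.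
Lemma n_not_s x y : n x y -> s x y -> False.
Proof. by case/andP=> _ /negP h /andP[_ /h]. Qed.
Lemma n_not_s' x y : n x y -> s y x -> False.
Proof. by rewrite s_symm; apply: n_not_s. Qed.
Lemma n_neq x y : n x y -> x != y.
Proof. by apply: contraTneq => ->; rewrite n_irr. Qed.
Lemma s_neq x y : s x y -> x != y.
Proof. by apply: contraTneq => ->; rewrite s_irr. Qed.

Hint Resolve n_arc s_arc s_arc' : core.

Variant related x y : Prop :=
  | RelEq of x = y | RelN of n x y | RelN' of n y x | RelS of s x y
  | RelNone of nonadj x y.

Lemma relatedP x y : related x y.
Proof.
have [->|ne] := eqVneq x y; first exact: RelEq.
case exy: (e x y); case eyx: (e y x).
- by apply: RelS; rewrite /sym_part exy.
- by apply: RelN; rewrite /nsym exy eyx.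
- by apply: RelN'; rewrite /nsym exy eyx.
- by apply: RelNone; rewrite /nonadj ne exy eyx.
Qed.

Lemma nonadj_in x y v : nonadj x y -> e x v -> e y v -> False.
Proof.
move=> /and3P[xy nxy nyx] xv yv; have [h _] := e_lsc v.
by have := h x y xv yv xy; rewrite (negbTE nxy) (negbTE nyx).
Qed.

Lemma nonadj_out x y v : nonadj x y -> e v x -> e v y -> False.
Proof.
move=> /and3P[xy nxy nyx] xv yv; have [_ h] := e_lsc v.
by have := h x y xv yv xy; rewrite (negbTE nxy) (negbTE nyx).
Qed.

Lemma no_triangle a b c : n a b -> n b c -> n c a -> False.
Proof.
move=> nab nbc nca; apply: noFd; pose f (i : 'I_3) := nth a [:: a; b; c] i.
exists f; split.
  move=> i j /eqP; rewrite nth_uniq // => [/eqP/val_inj //|].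
  by rewrite /= !inE !andbT !negb_or (n_neq nab) (n_neq nbc) [a == c]eq_sym (n_neq nca).
case/andP: nab => ab /negbTE ba; case/andP: nbc => bc /negbTE cb.
case/andP: nca => ca /negbTE ac.
by do 2![case=> [[|[|[|//]]] ?]]; rewrite /f /= ?e_irr.
Qed.

(** * Covered vertices, gaps and sinks *)

Definition cover a b c := [&& n a b, n b c & s a c].

Lemma no_crossing a b c d : cover a b c -> cover b c d -> False.
Proof.
move=> /and3P[nab nbc sac] /and3P[_ ncd sbd].
have ad : a != d by apply: contraTneq sbd => <-; apply/negP => /(n_not_s' nab).
(* Starting at [b] matches the numbering of the forbidden digraphs: only the arcs between [d] and
   [a] remain open, and they decide between Fa, Fb and Fc. *)
pose f (i : 'I_4) := nth a [:: b; c; d; a] i.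
have inj : injective f.
  move=> i j /eqP; rewrite nth_uniq // => [/eqP/val_inj //|].
  rewrite /= !inE !andbT !negb_or (n_neq nbc) (s_neq sbd) (n_neq ncd).
  by rewrite ![_ == a]eq_sym (n_neq nab) (s_neq sac) ad.
have F (H : rel 'I_4) : (forall i j, e (f i) (f j) = H i j) -> contains_induced H e.
  by move=> h; exists f.
case/andP: nab => ab /negbTE ba; case/andP: nbc => bc /negbTE cb.
case/andP: ncd => cd /negbTE dc; case/andP: sac => ac ca; case/andP: sbd => bd db.
case e_ad: (e a d); case e_da: (e d a).
- by apply: noFa; apply: F; do 2![case=> [[|[|[|[|//]]]] ?]]; rewrite /f /= ?e_irr.
- by apply: noFc; apply: F; do 2![case=> [[|[|[|[|//]]]] ?]]; rewrite /f /= ?e_irr.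
- by apply: noFb; apply: F; do 2![case=> [[|[|[|[|//]]]] ?]]; rewrite /f /= ?e_irr.
by apply: (@nonadj_out a d c); rewrite // /nonadj ad e_ad e_da.
Qed.

Lemma no_square a b c d : n a b -> n b c -> n c d -> n d a ->
  nonadj a c -> nonadj b d -> False.
Proof.
move=> nab nbc ncd nda oac obd.
pose f (i : 'I_4) := nth a [:: a; b; c; d] i.
have inj : injective f.
  move=> i j /eqP; rewrite nth_uniq // => [/eqP/val_inj //|].
  rewrite /= !inE !andbT !negb_or (n_neq nbc) (n_neq ncd) (n_neq nab).
  by rewrite [a == d]eq_sym (n_neq nda); case/and3P: oac => -> _ _; case/and3P: obd => ->.
case/andP: nab => ab /negbTE ba; case/andP: nbc => bc /negbTE cb.
case/andP: ncd => cd /negbTE dc; case/andP: nda => da /negbTE ad.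
case/and3P: oac => _ /negbTE ac /negbTE ca; case/and3P: obd => _ /negbTE bd /negbTE db.
apply: noC; exists 4; split=> //; exists f; split=> //.
by do 2![case=> [[|[|[|[|//]]]] ?]]; rewrite /f /= ?e_irr.
Qed.

(** The set of vertices covered by [a ~ c] is closed in Dirac's sense: local semicompleteness gives
    the adjacencies of [q] with [a] and [c], and a wrong direction would be a crossing. *)
Lemma cover_simplicial a b c : cover a b c -> exists2 v, simplicial s v & cover a v c.
Proof.
move=> cabc; have /and3P[nab nbc sac] := cabc.
have [||||v] := simplicial_in_closed s_irr s_symm e_chordal
    (Q := [set v | cover a v c]) (a := a) (c := c) (b := b).
- by rewrite sac orbT.
- move=> v; rewrite inE => /and3P[nav nvc _]; rewrite /off.
  rewrite eq_sym (n_neq nav) (n_neq nvc).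
  by apply/andP; split; apply/negP; [move/(n_not_s nav) | move/(n_not_s' nvc)].
- by rewrite inE.
- move=> p q; rewrite !inE => capc spq /andP[qa nsaq] /andP[qc nscq].
  have /and3P[nap npc _] := capc.
  have naq : n a q.
    case: (relatedP a q) => [aq|//|nqa|saq|oaq].
    + by rewrite aq eqxx in qa.
    + by case: (@no_crossing q a p c) => //; apply/and3P; split; rewrite // s_symm.
    + by rewrite saq in nsaq.
    + by case: (nonadj_in oaq (v := p)); auto.
  rewrite /cover naq sac andbT; case: (relatedP q c) => [qc'|//|ncq|sqc|oqc].
  + by rewrite qc' eqxx in qc.
  + by case: (@no_crossing a p c q) => //; apply/and3P.
  + by rewrite s_symm sqc in nscq.
  + by case: (nonadj_out oqc (v := p)); auto.
by rewrite inE => cv sv; exists v.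
Qed.

Definition gap i v o := [&& n i v, n v o & nonadj i o].

(** Dirac's argument at the single vertex [v], with [i] fixed. Being nonadjacent to [i] spreads from
    [p] to [q] along [p ~ q], since an arc between [i] and [q] would give [q] the nonadjacent in- or
    out-neighbours [i] and [p]. *)
Lemma gap_simplicial i v o : gap i v o -> exists o', simplicial s o' /\ gap i v o'.
Proof.
move=> giv; have /and3P[niv nvo oio] := giv.
have [||||w] := simplicial_in_closed s_irr s_symm e_chordal
    (Q := [set w | gap i v w]) (a := v) (c := v) (b := o).
- by rewrite eqxx.
- move=> w; rewrite inE => /and3P[_ nvw _]; rewrite andbb /off eq_sym (n_neq nvw).
  by apply/negP => /(n_not_s nvw).
- by rewrite inE.
- move=> p q; rewrite !inE => /and3P[_ nvp oip] spq /andP[qv nsvq] _.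
  have oiq : nonadj i q.
    have opi := oip; rewrite nonadj_sym in opi.
    case: (relatedP i q) => [iq|niq|nqi|siq|//].
    + by move: oip; rewrite iq => /and3P[_]; rewrite (s_arc' spq).
    + by case: (nonadj_in oip (v := q)); auto.
    + by case: (nonadj_out oip (v := q)); auto.
    + by case: (nonadj_in oip (v := q)); auto.
  rewrite /gap niv oiq andbT; case: (relatedP v q) => [vq|//|nqv|svq|ovq].
  + by rewrite vq eqxx in qv.
  + by case: (nonadj_in oiq (v := v)); auto.
  + by rewrite svq in nsvq.
  + by case: (nonadj_in ovq (v := p)); auto.
by rewrite inE => gv sv; exists w.
Qed.

(** First [i], [c] and [a], [o] are adjacent, since the arc [a ~ c] passes adjacency on. The absence
    of directed triangles then orients them, and a reverse arc would give [a] or [c] both [i] and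
    [o] as in- or out-neighbours. *)
Lemma gap_cover a v c i o : cover a v c -> gap i v o ->
  [/\ n i a, n i c, n a o & n c o].
Proof.
move=> /and3P[nav nvc sac] /and3P[niv nvo oio].
have oic : ~ nonadj i c.
  move=> oic; case: (relatedP i a) => [ia|nia|nai|sia|oia].
  - by move: oic; rewrite ia => /and3P[_]; rewrite (s_arc sac).
  - by apply: (nonadj_in oic (v := a)); auto.
  - by apply: (nonadj_out oic (v := a)); auto.
  - by apply: (nonadj_in oic (v := a)); auto.
  - by apply: (nonadj_in oia (v := v)); auto.
have oao : ~ nonadj a o.
  move=> oao; case: (relatedP c o) => [co|nco|noc|sco|oco].
  - by move: oao; rewrite -co => /and3P[_]; rewrite (s_arc sac).
  - by apply: (nonadj_out oao (v := c)); auto.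
  - by apply: (nonadj_in oao (v := c)); auto.
  - by apply: (nonadj_out oao (v := c)); auto.
  - by apply: (nonadj_out oco (v := v)); auto.
have eao : e a o.
  case: (relatedP a o) => [ao|nao|noa|sao|//]; auto.
  - by case: (n_asym nav); rewrite ao.
  - by case: (no_triangle nav nvo noa).
have eic : e i c.
  case: (relatedP i c) => [ic|nic|nci|sic|//]; auto.
  - by case: (n_asym niv); rewrite ic.
  - by case: (no_triangle niv nvc nci).
have nia : n i a.
  case: (relatedP i a) => [ia|//|nai|sia|oia].
  - by case: oao; rewrite -ia.
  - by case: (nonadj_out oio (v := a)); auto.
  - by case: (nonadj_out oio (v := a)); auto.
  - by case: (nonadj_in oia (v := v)); auto.
have nco : n c o.
  case: (relatedP c o) => [co|//|noc|sco|oco].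
  - by case: oic; rewrite co.
  - by case: (nonadj_in oio (v := c)); auto.
  - by case: (nonadj_in oio (v := c)); auto.
  - by case: (nonadj_out oco (v := v)); auto.
split=> //.
- by rewrite /nsym eic /=; apply/negP => eci; case: (nonadj_out oio (v := c)); auto.
- by rewrite /nsym eao /=; apply/negP => eoa; case: (nonadj_in oio (v := a)); auto.
Qed.

(** Used to choose a last simplicial vertex in an interval. Longer directed cycles have symmetric
    chords here, so excluding them takes [no_crossing] besides [no_triangle]. *)
Lemma sink_exists (A : {set T}) z : z \in A -> {in A &, forall x y, ~ nonadj x y} ->
  exists2 w, w \in A & {in A, forall x, ~ n w x}.
Proof.
have [m] := ubnP #|A|; elim: m A z => // m IH A z cardA zA adjA.
have [y0 y0A|noY] := pickP [pred y in A | n z y]; last first.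
  by exists z => // x xA nzx; move: (noY x); rewrite /= xA nzx.
have cardz (B : {set T}) : B \subset A :\ z -> #|B| < m.
  move/subset_leq_card => le; apply: leq_ltn_trans le _.
  by move: cardA; rewrite (cardsD1 z A) zA.
have sub (B : {set T}) : B \subset A :\ z -> {in B &, forall x y, ~ nonadj x y}.
  by move=> /subsetP BA x y /BA/setD1P[_ xA] /BA/setD1P[_ yA]; apply: adjA.
case/andP: y0A => y0A nzy0.
have [|t tA tsink] := IH (A :\ z) y0 (cardz _ (subxx _)) _ (sub _ (subxx _)).
  by rewrite !inE y0A eq_sym (n_neq nzy0).
have /setD1P[tz tA'] := tA.
have [ntz|ntz] := boolP (n t z); last first.
  exists t => // x xA ntx; have [xz|xz] := eqVneq x z; first by rewrite -xz ntx in ntz.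
  by apply: (tsink x) => //; rewrite !inE xz.
(* The sink [t] of the rest precedes [z]. A sink [y] of the successors of [z] satisfies [t ~ y], so
   any [y -> x] closes a triangle with [z], contradicts the choice of [y], or creates a crossing. *)
pose Y := [set y in A | n z y].
have YA : Y \subset A :\ z.
  by apply/subsetP => y; rewrite !inE => /andP[-> nzy]; rewrite eq_sym (n_neq nzy).
have [|y yY ysink] := IH Y y0 (cardz _ YA) _ (sub _ YA); first by rewrite inE y0A.
move: (yY); rewrite inE => /andP[yA nzy]; exists y => // x xA nyx.
have cty : cover t z y.
  apply/and3P; split=> //; case: (relatedP t y) => [ty|nty|nyt|//|/adjA h].
  - by case: (n_asym ntz); rewrite ty.
  - by case: (tsink y) => //; move/subsetP: YA; apply.
  - by case: (no_triangle ntz nzy nyt).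
  - by case: h.
case: (relatedP z x) => [zx|nzx|nxz|szx|/adjA h].
- by apply: (n_asym nzy); rewrite zx.
- by apply: (ysink x); rewrite // inE xA.
- exact: (no_triangle nzy nyx nxz).
- by apply: (no_crossing cty (d := x)); apply/and3P.
- exact: h.
Qed.

(** * Good vertices *)

Definition good v :=
  [&& simplicial s v, [forall b, forall c, ~~ cover v b c]
    & [forall i, forall o, ~~ gap i v o]].

Lemma goodP v :
  reflect [/\ simplicial s v, forall b c, ~ cover v b c & forall i o, ~ gap i v o]
          (good v).
Proof.
apply: (iffP and3P) => [[sv /'forall_forallP nc /'forall_forallP ng]|[sv nc ng]]; split=> //.
- by move=> b c; apply/negP.
- by move=> i o; apply/negP.
- by apply/'forall_forallP => b c; apply/negP.
- by apply/'forall_forallP => i o; apply/negP.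
Qed.

Lemma good_or_succ v : simplicial s v ->
  good v \/ exists2 w, simplicial s w & n v w.
Proof.
move=> sv; have [gv|] := boolP (good v); [by left | move=> ngv; right].
move: ngv; rewrite /good sv /= negb_and.
case/orP => [/forallPn[b' /forallPn[c]]|/forallPn[i /forallPn[o]]]; rewrite negbK.
  by case/cover_simplicial => w sw /and3P[nvw _ _]; exists w.
by case/gap_simplicial => w [sw /and3P[_ nvw _]]; exists w.
Qed.

(** * Closed walks of simplicial vertices and existence of a good vertex *)

Definition walk (f : nat -> T) := forall i, simplicial s (f i) /\ n (f i) (f i.+1).

(** Closed walks are encoded as periodic infinite ones; here a segment of [L] vertices is repeated
    forever. *)
Lemma walk_close f j L : walk f -> 0 < L -> n (f (j + L.-1)) (f j) ->
  exists g, walk g /\ forall i, g (i + L) = g i.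
Proof.
move=> wf L0 nlast; exists (fun m => f (j + m %% L)); split; last first.
  by move=> i; rewrite modnDr.
move=> m; split; first by case: (wf (j + m %% L)).
rewrite modnS; case: ifP => [dv|_]; last by rewrite addnS; case: (wf (j + m %% L)).
suff -> : m %% L = L.-1 by rewrite addn0.
have : L <= (m %% L).+1 by apply: dvdn_leq; rewrite // /dvdn -addn1 modnDml addn1.
by have := ltn_pmod m L0; lia.
Qed.

Section NoClosedWalk.
(** Satisfied when no vertex is good, by [good_of_half_square]. *)
Hypothesis no_half_square : forall v0 v1 v2 v3, n v0 v1 -> n v1 v2 -> n v2 v3 ->
  n v3 v0 -> s v0 v2 -> nonadj v1 v3 -> False.

Lemma no_closed_walk k f : 0 < k -> walk f -> (forall i, f (i + k) = f i) -> False.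
Proof.
elim/ltn_ind: k f => k IH f k0 wf per.
have nf i : n (f i) (f i.+1) by case: (wf i).
have sf i : simplicial s (f i) by case: (wf i).
have short j L : 0 < L -> L < k -> n (f (j + L.-1)) (f j) -> False.
  by move=> L0 Lk /(walk_close wf L0)[g [wg pg]]; apply: (IH L Lk g).
have k3 : 3 < k.
  case: k k0 per {IH short} => [|[|[|[|]]]] // _ per; exfalso.
  - by have := nf 0; rewrite -(per 0) n_irr.
  - by apply: (n_asym (nf 0)); rewrite -(per 0); apply: nf.
  - by apply: (no_triangle (nf 0) (nf 1)); rewrite -(per 0); apply: nf.
(* Equality or a nonsymmetric chord in either direction would close a shorter walk. *)
have chord i d : 1 < d -> d.+1 < k -> s (f i) (f (i + d)) \/ nonadj (f i) (f (i + d)).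
  move=> d1 dk; case: (relatedP (f i) (f (i + d))) => [eqf|nid|ndi||]; try by auto.
  - case: (short i d); try lia; rewrite eqf.
    by have := nf (i + d.-1); congr (is_true (n _ (f _))); lia.
  - case: (short (i + d) (k - d).+1); try lia.
    by rewrite /= -addnA subnKC ?per //; lia.
  - by case: (short i d.+1); try lia.
(* Compare with the chord one step shorter: if symmetric, simpliciality of [f i] makes a walk arc
   symmetric; if absent, [f (i + d)] has two nonadjacent in-neighbours. [chord3] does the same one
   step longer. *)
have chord2 i d : 2 < d -> d.+1 < k -> ~ s (f i) (f (i + d)).
  move=> d2 dk sid; have [d' dE] : exists d', d = d'.+1 by exists d.-1; lia.
  have := nf (i + d'); rewrite -addnS -dE => nd.
  case: (chord i d'); [lia|lia| |] => h.
    by apply: (n_not_s nd); apply: (simplicialP _ _ (sf i)) => //; apply: n_neq.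
  by apply: (nonadj_in h (v := f (i + d))); auto.
have chord3 i d : 1 < d -> d.+2 < k -> ~ s (f i) (f (i + d)).
  move=> d2 dk sid; have nd := nf (i + d).
  case: (chord i d.+1); [lia|lia| |]; rewrite addnS => h.
    by apply: (n_not_s nd); apply: (simplicialP _ _ (sf i)) => //; apply: n_neq.
  by apply: (nonadj_out h (v := f (i + d))); auto.
(* For [k = 4] both diagonals may be symmetric or absent; for larger [k], [chord2] and [chord3]
   together exclude every chord. *)
have [k4|k4] := eqVneq k 4.
  have f4 : f 4 = f 0 by rewrite -k4 (per 0).
  have n3 := nf 3; rewrite f4 in n3.
  case: (chord 0 2); case: (chord 1 2); rewrite ?k4 // => h1 h0.
  - by apply: (@no_crossing (f 0) (f 1) (f 2) (f 3)); apply/and3P.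
  - exact: (no_half_square (nf 0) (nf 1) (nf 2) n3).
  - by apply: (no_half_square (nf 1) (nf 2) n3 (nf 0)); rewrite // nonadj_sym.
  - exact: (no_square (nf 0) (nf 1) (nf 2) n3).
have far i d : 1 < d -> d.+1 < k -> nonadj (f i) (f (i + d)).
  move=> d1 dk; case: (chord i d d1 dk) => // sid.
  have [d2|d2] := ltnP 2 d; first by case: (chord2 i d).
  by case: (chord3 i d) => //; lia.
have key i j : i < j -> j < k -> [/\ f i != f j, e (f i) (f j) = (j == i.+1)
    & e (f j) (f i) = (i == 0) && (j.+1 == k)].
  move=> ij jk; have [jE|ji] := eqVneq j i.+1.
    subst j; rewrite (n_neq (nf i)) (n_arc (nf i)).
    by have /andP[_ /negbTE ->] := nf i; split=> //; lia.
  have [/andP[/eqP i0 /eqP jk']|njk] := boolP ((i == 0) && (j.+1 == k)).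
    have := nf j; rewrite jk' -[k]add0n per i0 => nj.
    by rewrite eq_sym (n_neq nj) (n_arc nj); case/andP: nj => _ /negbTE ->.
  have : nonadj (f i) (f (i + (j - i))) by apply: far; lia.
  by rewrite subnKC; [case/and3P=> -> /negbTE -> /negbTE -> | lia].
apply: noC; exists k; split; first by lia.
exists (fun i : 'I_k => f i); split.
  move=> i j fij; apply: val_inj => /=.
  case: (ltngtP i j) => // ij.
    by case: (key _ _ ij (ltn_ord j)); rewrite fij eqxx.
  by case: (key _ _ ij (ltn_ord i)); rewrite fij eqxx.
have modS i : i < k -> i.+1 %% k = if i.+1 == k then 0 else i.+1.
  by move=> ik; case: eqP => [->|ne]; rewrite ?modnn // modn_small //; lia.
move=> [i ik] [j jk]; rewrite /dcycle_rel /= !modS //.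
case: (ltngtP i j) => [ij|ji|->].
- by case: (key _ _ ij jk) => _ -> _; do 2!case: ifP; lia.
- by case: (key _ _ ji ik) => _ _ ->; do 2!case: ifP; lia.
- by rewrite e_irr andbN.
Qed.

End NoClosedWalk.

(* A nonsymmetric 4-cycle with exactly one chord: the interval of [v0 v2] is
   shut off from the rest by [v3], so its last simplicial vertex is good. *)
Lemma good_of_half_square v0 v1 v2 v3 : n v0 v1 -> n v1 v2 -> n v2 v3 -> n v3 v0 ->
  s v0 v2 -> exists w, good w.
Proof.
move=> n01 n12 n23 n30 s02.
have [z sz cz] : exists2 z, simplicial s z & cover v0 z v2.
  by apply: (@cover_simplicial v0 v1 v2); apply/and3P.
pose A := [set w | simplicial s w && cover v0 w v2].
have [|x y|w] := @sink_exists A z; first by rewrite inE sz.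
  rewrite !inE => /andP[_ /and3P[n0x _ _]] /andP[_ /and3P[n0y _ _]] oxy.
  by apply: (nonadj_out oxy (v := v0)); auto.
rewrite inE => /andP[sw c0w] sink; have /and3P[n0w nw2 _] := c0w.
have ow3 : nonadj w v3.
  case: (relatedP w v3) => [w3|nw3|n3w|sw3|//].
  - by case: (n_asym n0w); rewrite w3.
  - by case: (no_triangle n0w nw3 n30).
  - by case: (no_triangle nw2 n23 n3w).
  - by case: (no_crossing c0w (d := v3)); apply/and3P.
exists w; apply/goodP; split=> // [u y cwuy|i o giwo].
  (* Nonadjacency to [v3] passes from [w] to [y] and [u], which forces [u] into the interval after
     [w], against the choice of [w]. *)
  have {u cwuy}[u su /and3P[nwu nuy swy]] := cover_simplicial cwuy.
  have oy3 : nonadj y v3.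
    case: (relatedP y v3) => [y3|ny3|n3y|sy3|//].
    - by move: ow3; rewrite -y3 => /and3P[_]; rewrite (s_arc swy).
    - by case: (nonadj_out ow3 (v := y)); auto.
    - by case: (nonadj_in ow3 (v := y)); auto.
    - by case: (nonadj_out ow3 (v := y)); auto.
  have ou3 : nonadj u v3.
    case: (relatedP u v3) => [u3|nu3|n3u|su3|//].
    - by move: ow3; rewrite -u3 => /and3P[_]; rewrite (n_arc nwu).
    - by case: (nonadj_out oy3 (v := u)); auto.
    - by case: (nonadj_in ow3 (v := u)); auto.
    - by case: (nonadj_in ow3 (v := u)); auto.
  have nu2 : n u v2.
    case: (relatedP u v2) => [u2|//|n2u|su2|ou2].
    - by move: ou3; rewrite u2 => /and3P[_]; rewrite (n_arc n23).
    - by case: (nonadj_out ou3 (v := v2)); auto.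
    - by case: (nonadj_out ou3 (v := v2)); auto.
    - by case: (nonadj_out ou2 (v := w)); auto.
  have n0y : n v0 y.
    case: (relatedP v0 y) => [y0|//|ny0|sy0|oy0].
    - by move: oy3; rewrite -y0 => /and3P[_ _]; rewrite (n_arc n30).
    - by case: (nonadj_in oy3 (v := v0)); auto.
    - by case: (nonadj_in oy3 (v := v0)); auto.
    - by case: (nonadj_in oy0 (v := w)); auto.
  have n0u : n v0 u.
    case: (relatedP v0 u) => [u0|//|nu0|su0|ou0].
    - by move: ou3; rewrite -u0 => /and3P[_ _]; rewrite (n_arc n30).
    - by case: (nonadj_in ou3 (v := v0)); auto.
    - by case: (nonadj_in ou3 (v := v0)); auto.
    - by case: (nonadj_in ou0 (v := y)); auto.
  by apply: (sink u); rewrite // inE su /=; apply/and3P.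
(* A gap at [w] would close up through [v3] to an induced directed 4-cycle. *)
have [ni0 _ _ n2o] := gap_cover c0w giwo; have /and3P[niw nwo oio] := giwo.
apply: (@no_square i w o v3) => //.
  case: (relatedP o v3) => [o3|//|n3o|so3|oo3].
  - by move: ow3; rewrite -o3 => /and3P[_ ]; rewrite (n_arc nwo).
  - by case: (nonadj_in ow3 (v := o)); auto.
  - by case: (nonadj_in ow3 (v := o)); auto.
  - by case: (nonadj_out oo3 (v := v2)); auto.
case: (relatedP i v3) => [i3|ni3|//|si3|oi3].
- by move: ow3; rewrite -i3 => /and3P[_ _]; rewrite (n_arc niw).
- by case: (nonadj_out ow3 (v := i)); auto.
- by case: (nonadj_out ow3 (v := i)); auto.
- by case: (nonadj_in oi3 (v := v0)); auto.
Qed.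

Lemma good_exists (v : T) : exists w, good w.
Proof.
have [/existsP //|] := boolP [exists w, good w]; rewrite negb_exists => /forallP nogood.
have nhs v0 v1 v2 v3 : n v0 v1 -> n v1 v2 -> n v2 v3 -> n v3 v0 ->
    s v0 v2 -> nonadj v1 v3 -> False.
  move=> n01 n12 n23 n30 s02 _.
  by have [w] := good_of_half_square n01 n12 n23 n30 s02; apply/negP.
have [v0 [_ v0P]] : exists v0, disimplicial_in s setT v0.
  by apply: (e_chordal (A := setT)); apply/set0Pn; exists v.
(* The default is never taken at a simplicial vertex, as no vertex is good. *)
pose g v := odflt v [pick w | simplicial s w && n v w].
have gP u : simplicial s u -> simplicial s (g u) && n u (g u).
  move=> su; rewrite /g; case: pickP => [//|none] /=.
  case: (good_or_succ su) => [gu|[w sw nuw]]; first by case/negP: (nogood u).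
  by have := none w; rewrite sw nuw.
have s0 : simplicial s v0.
  by apply/simplicialP => x y sx sy; apply: v0P; rewrite ?inE // s_symm.
pose f i := iter i g v0.
have sf i : simplicial s (f i) by elim: i => [//|i /gP /andP[]].
have wf : walk f by move=> i; split=> //; case/andP: (gP _ (sf i)).
(* By finiteness the orbit of [v0] returns at time [N] to its value at time [i], so the segment from
   [i] to [N - 1] closes up. *)
have /trajectP[i iN fN] := looping_order g v0; exfalso.
set N := order g v0 in iN fN; pose L := N - i.
have [||h [wh ph]] := @walk_close f i L wf; rewrite /L ?subn_gt0 //.
  have -> : f i = f N by [].
  by case: (wf (i + (N - i).-1)) => _; congr (is_true (n _ (f _))); lia.
by apply: (no_closed_walk nhs _ wh ph); rewrite subn_gt0.
Qed.

(** * A first good vertex is di-simplicial *)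

Lemma good_trans u v w : good u -> good v -> n u v -> n v w -> n u w.
Proof.
case/goodP=> _ ncu _; case/goodP=> _ _ ngv nuv nvw.
case: (relatedP u w) => [uw|//|nwu|suw|ouw].
- by case: (n_asym nuv); rewrite uw.
- by case: (no_triangle nuv nvw nwu).
- by case: (ncu v w); apply/and3P.
- by case: (ngv u w); apply/and3P.
Qed.

(* If [y -> x -> v] covers a good [v] from the left, the last simplicial vertex
   in the interval of [yv] is again good. *)
Lemma good_pred v y x : good v -> cover y x v -> exists2 w, good w & n w v.
Proof.
case/goodP=> sv ncv ngv; case/cover_simplicial=> z sz cz.
pose A := [set w | simplicial s w && cover y w v].
have [|a b|w] := @sink_exists A z; first by rewrite inE sz.
  rewrite !inE => /andP[_ /and3P[nya _ _]] /andP[_ /and3P[nyb _ _]] oab.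
  by apply: (nonadj_out oab (v := y)); auto.
rewrite inE => /andP[sw cywv] sink; have /and3P[nyw nwv syv] := cywv.
exists w => //; apply/goodP; split=> // [b y' cwby'|i o giwo]; last first.
  (* A gap at [w] is also a gap at the good vertex [v]. *)
  have [_ niv _ nvo] := gap_cover cywv giwo; have /and3P[_ _ oio] := giwo.
  by apply: (ngv i o); apply/and3P.
have {b cwby'}[u su cwuy'] := cover_simplicial cwby'.
have /and3P[nwu nuy' swy'] := cwuy'.
have sv_clique := simplicialP _ _ sv; have svy : s v y by rewrite s_symm.
have nuy : ~ s u y.
  move=> suy; apply: (@no_crossing y w u y') => //; apply/and3P; split=> //.
  by rewrite s_symm.
have uy : u != y by apply: contraTneq nwu => ->; apply/negP => /(n_asym nyw).
have uv_sy : ~ s v u.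
  by move=> svu; apply: nuy; apply: sv_clique.
(* Such a [u] would lie in the interval of [y ~ v] after [w]. *)
have step : n u v -> False.
  move=> nuv; apply: (sink u) => //; rewrite inE su /=; apply/and3P; split=> //.
  case: (relatedP y u) => [yu|//|nuy0|syu|oyu].
  - by rewrite yu eqxx in uy.
  - by case: (no_triangle nyw nwu nuy0).
  - by case: nuy; rewrite s_symm.
  - by case: (nonadj_in oyu (v := v)); auto.
case: (relatedP v y') => [vy'|nvy'|ny'v|svy'|ovy'].
- by apply: (n_not_s nwv); rewrite vy'.
- by apply: (no_crossing cywv (d := y')); apply/and3P.
- case: (relatedP v u) => [vu|nvu|//|//|ovu].
  + by apply: (n_asym nuy'); rewrite -vu.
  + by apply: (no_triangle nvu nuy').
  + by apply: (nonadj_out ovu (v := w)); auto.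
- case: (relatedP v u) => [vu|nvu|//|//|ovu].
  + by apply: (n_not_s nuy'); rewrite -vu.
  + by apply: (ncv u y'); apply/and3P.
  + by apply: (nonadj_out ovu (v := w)); auto.
- by apply: (nonadj_out ovy' (v := w)); auto.
Qed.

Lemma disimplicial_exists (v : T) : exists w, disimplicial_in e setT w.
Proof.
have [g0 gg0] := good_exists v.
(* Minimising the number of good predecessors gives a first good vertex: by transitivity a good
   predecessor would have strictly fewer. *)
pose before w := [set u | good u && n u w].
have [w gw wmin] := arg_minnP (fun w => #|before w|) gg0.
have nlc y x : ~ cover y x w.
  case/(good_pred gw) => u gu nuw.
  have := wmin u gu; rewrite leqNgt => /negP; apply; apply: proper_card.
  apply/properP; split.
    apply/subsetP => t; rewrite !inE => /andP[gt ntu].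
    by rewrite gt (good_trans gt gu ntu nuw).
  by exists u; rewrite !inE gu ?n_irr.
have /goodP[sw nc ng] := gw.
exists w; split=> // x y _ _ exw ewy xy.
case: (relatedP x y) => [xyE|/n_arc//|nyx|/s_arc//|oxy].
- by rewrite xyE eqxx in xy.
(* According to which of [x -> w -> y] are symmetric, [y -> x] contradicts simpliciality, a cover
   after [w], a cover before [w], or [no_triangle]. *)
- case ewx: (e w x); case eyw: (e y w).
  + by apply: s_arc; apply: (simplicialP _ _ sw); rewrite // /sym_part ?ewx ?ewy.
  + by case: (nc y x); apply/and3P; split; rewrite // /nsym /sym_part ?ewy ?eyw ?ewx.
  + by case: (nlc y x); apply/and3P; split; rewrite // /nsym /sym_part ?exw ?ewx ?eyw.
  + by case: (@no_triangle x w y) => //; rewrite /nsym ?exw ?ewx ?ewy ?eyw.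
- case ewx: (e w x); first by case: (nonadj_out oxy (v := w)).
  case eyw: (e y w); first by case: (nonadj_in oxy (v := w)).
  by case: (ng x y); rewrite /gap oxy /nsym exw ewx ewy eyw.
Qed.

End LocallySemicomplete.

(** * Passage to induced subdigraphs *)

Section Restriction.
Variables (T : finType) (e : rel T) (A : {set T}).

Definition restrict : rel {x | x \in A} := fun x y => e (val x) (val y).

Lemma contains_induced_restrict k (H : rel 'I_k) :
  contains_induced H restrict -> contains_induced H e.
Proof.
case=> f [inj_f fH]; exists (fun i => val (f i)); split=> [i j /val_inj/inj_f //|].
exact: fH.
Qed.

Lemma locally_semicomplete_restrict :
  locally_semicomplete e -> locally_semicomplete restrict.
Proof.
move=> lsc v; have [hi ho] := lsc (val v).
by split=> x y xv yv xy; [apply: hi | apply: ho].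
Qed.

Lemma chordal_sym_restrict : chordal (sym_part e) -> chordal (sym_part restrict).
Proof.
move=> ch B /set0Pn[b bB].
have [|v [/imsetP[v' v'B ->] vP]] := ch [set val x | x in B].
  by apply/set0Pn; exists (val b); apply: imset_f.
exists v'; split=> // x y xB yB sx sy xy.
by apply: (vP (val x) (val y)) => //; apply: imset_f.
Qed.

Lemma disimplicial_restrict w :
  disimplicial_in restrict setT w -> disimplicial_in e A (val w).
Proof.
case=> _ wP; split; first exact: valP.
move=> x y xA yA; by apply: (wP (exist _ x xA) (exist _ y yA)); rewrite inE.
Qed.

End Restriction.

(** * Necessity of the conditions, and the equivalence *)

Lemma not_contains_induced (T : finType) (e : rel T) k (H : rel 'I_k) (i0 : 'I_k) :
  (forall i, exists u w, [/\ H u i, H i w, u != w & ~~ H u w]) ->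
  chordal e -> ~ contains_induced H e.
Proof.
move=> nods ch [f [inj_f fH]].
have [|v [/imsetP[i _ ->] vP]] := ch [set f i | i in setT].
  by apply/set0Pn; exists (f i0); apply: imset_f.
have [u [w [Hui Hiw uw /negP]]] := nods i; apply; rewrite -fH.
by apply: vP; rewrite ?fH ?(inj_eq inj_f) //; apply: imset_f.
Qed.

Lemma chordal_sym_part (T : finType) (e : rel T) : chordal e -> chordal (sym_part e).
Proof.
move=> ch A /ch[v [vA vP]]; exists v; split=> // u w uA wA.
move=> /andP[uv vu] /andP[vw wv] uw.
by apply/andP; split; apply: vP => //; rewrite eq_sym.
Qed.

Lemma chordal_no_nonsym_dcycle (T : finType) (e : rel T) :
  chordal e -> ~ contains_induced_nonsym_dcycle e.
Proof.
move=> ch [k [k3]]; case: k k3 => // k k3; apply: (not_contains_induced ord0) ch.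
have modS i : i < k.+1 -> i.+1 %% k.+1 = if i.+1 == k.+1 then 0 else i.+1.
  by move=> ik; case: eqP => [->|ne]; rewrite ?modnn // modn_small //; lia.
move=> [i ik].
(* The cyclic predecessor and successor of [i]; the cycle length is now [k.+1]. *)
have pk : (if i is i'.+1 then i' else k) < k.+1 by case: i ik => //; lia.
have qk : (if i == k then 0 else i.+1) < k.+1 by case: eqP; lia.
exists (Ordinal pk), (Ordinal qk); rewrite /dcycle_rel -val_eqE /= !modS //.
by case: i ik {pk qk} => [|i] ik; split; do ?case: eqP; lia.
Qed.

Theorem theorem2p4 (T : finType) (e : rel T) :
  irreflexive e -> locally_semicomplete e ->
  (chordal e <->
   chordal (sym_part e) /\
   ~ contains_induced_nonsym_dcycle e /\
   ~ contains_induced Fa e /\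
   ~ contains_induced Fb e /\
   ~ contains_induced Fc e /\
   ~ contains_induced Fd e).
Proof.
move=> e_irr e_lsc; split=> [ch|[chS [noC [noFa [noFb [noFc noFd]]]]]].
  do !split; first exact: chordal_sym_part.
  - exact: chordal_no_nonsym_dcycle.
  - apply: (not_contains_induced ord0) ch.
    case=> [[|[|[|[|//]]]] ?].
    (* Here and below, the missing arc from the in-neighbour to the out-neighbour is the reverse of
       a nonsymmetric arc. *)
    + by exists (@Ordinal 4 2 isT), (@Ordinal 4 1 isT).
    + by exists (@Ordinal 4 0 isT), (@Ordinal 4 3 isT).
    + by exists (@Ordinal 4 1 isT), (@Ordinal 4 0 isT).
    + by exists (@Ordinal 4 2 isT), (@Ordinal 4 1 isT).
  - apply: (not_contains_induced ord0) ch.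
    case=> [[|[|[|[|//]]]] ?].
    + by exists (@Ordinal 4 2 isT), (@Ordinal 4 1 isT).
    + by exists (@Ordinal 4 0 isT), (@Ordinal 4 3 isT).
    + by exists (@Ordinal 4 1 isT), (@Ordinal 4 0 isT).
    + by exists (@Ordinal 4 2 isT), (@Ordinal 4 1 isT).
  - apply: (not_contains_induced ord0) ch.
    case=> [[|[|[|[|//]]]] ?].
    + by exists (@Ordinal 4 2 isT), (@Ordinal 4 1 isT).
    + by exists (@Ordinal 4 0 isT), (@Ordinal 4 3 isT).
    + by exists (@Ordinal 4 1 isT), (@Ordinal 4 0 isT).
    + by exists (@Ordinal 4 1 isT), (@Ordinal 4 0 isT).
  - apply: (not_contains_induced ord0) ch.
    case=> [[|[|[|//]]] ?].
    + by exists (@Ordinal 3 2 isT), (@Ordinal 3 1 isT).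
    + by exists (@Ordinal 3 0 isT), (@Ordinal 3 2 isT).
    + by exists (@Ordinal 3 1 isT), (@Ordinal 3 0 isT).
(* All hypotheses are hereditary, so a di-simplicial vertex of the subdigraph induced on [A]
   suffices. *)
move=> A /set0Pn[a aA].
have nr k (H : rel 'I_k) : ~ contains_induced H e -> ~ contains_induced H (@restrict T e A).
  by move=> nH /contains_induced_restrict.
have [|||||||||w wP] := @disimplicial_exists _ (@restrict T e A).
- by move=> x; apply: e_irr.
- exact: locally_semicomplete_restrict.
- exact: chordal_sym_restrict.
- by case=> k [k3 /contains_induced_restrict Hk]; apply: noC; exists k.
- exact: nr.
- exact: nr.
- exact: nr.
- exact: nr.
- exact: (exist _ a aA).
by exists (val w); apply: disimplicial_restrict.
Qed.
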